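(* Let $\mathcal{P}=\{1,\ldots,p\}$, let $(U_-^i,X^i)$ be the initialization data of mode $i\in\mathcal{P}$, and let $(U_-^{\mathrm{on}},X^{\mathrm{on}})$ be the online data. For $i\in\mathcal{P}$, the data $(U_-^i,X^i)$ and $(U_-^{\mathrm{on}},X^{\mathrm{on}})$ are compatible if and only if $$ \ker\begin{bmatrix} X^i_- & X^{\mathrm{on}}_- \\ U^i_- & U^{\mathrm{on}}_- \end{bmatrix}\subseteq\ker\begin{bmatrix}X^i_+ & X^{\mathrm{on}}_+\end{bmatrix}. $$
   Context: Given measurements of a state $x(t)\in\mathbb{R}^n$ and an input $u(t)\in\mathbb{R}^m$ on $\{0,\ldots,T\}$, define $X:=[x(0)\ \cdots\ x(T)]$, $U_-:=[u(0)\ \cdots\ u(T-1)]$, $X_+:=[x(1)\ \cdots\ x(T)]$, $X_-:=[x(0)\ \cdots\ x(T-1)]$, and $$\Sigma(U_-,X):=\{(A,B)\in\mathbb{R}^{n\times n}\times\mathbb{R}^{n\times m}: X_+=AX_-+BU_-\}.$$ For the initialization data of mode $i$ these matrices carry the superscript $i$, and for the online data the superscript $\mathrm{on}$ (the lengths of the two data sets may differ). Initialization data of mode $i$ are noiseless measurements of $x(t+1)=A_ix(t)+B_iu(t)$ for unknown $(A_i,B_i)\in\mathbb{R}^{n\times n}\times\mathbb{R}^{n\times m}$; online data are noiseless measurements collected while the switched system $x(t+1)=A_{\sigma(t)}x(t)+B_{\sigma(t)}u(t)$, $\sigma:\mathbb{N}\to\mathcal{P}$, dwells in one (unknown) mode.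 Definition: $(U_-^i,X^i)$ and $(U_-^{\mathrm{on}},X^{\mathrm{on}})$ are compatible if $\Sigma(U_-^i,X^i)\cap\Sigma(U_-^{\mathrm{on}},X^{\mathrm{on}})\neq\emptyset$. *)

(* Defs.v *)
From HB Require Import structures.
From mathcomp Require Import all_boot all_order all_algebra.
From mathcomp Require Import classical_sets reals.

Set Implicit Arguments.
Unset Strict Implicit.
Unset Printing Implicit Defensive.

Import GRing.Theory.
Local Open Scope classical_set_scope.
Local Open Scope ring_scope.

Section Data.
Variable R : realType.
Variables n m : nat.

(* X = [x(0) ... x(T)], with T + 1 columns. *)
Definition state_data (T : nat) (x : nat -> 'cV[R]_n) : 'M[R]_(n, T.+1) :=
  \matrix_(k < n, t < T.+1) x t k 0.

(* U_- = [u(0) ... u(T-1)], with T columns: the last input sample is unused. *)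
Definition input_data (T : nat) (u : nat -> 'cV[R]_m) : 'M[R]_(m, T) :=
  \matrix_(k < m, t < T) u t k 0.

(* X_- : all columns of X but the last. *)
Definition past (T : nat) (X : 'M[R]_(n, T.+1)) : 'M[R]_(n, T) :=
  colsub (widen_ord (leqnSn T)) X.

(* X_+ : all columns of X but the first. *)
Definition future (T : nat) (X : 'M[R]_(n, T.+1)) : 'M[R]_(n, T) :=
  colsub (lift ord0) X.

Definition Sigma (T : nat) (U : 'M[R]_(m, T)) (X : 'M[R]_(n, T.+1)) :
    set ('M[R]_n * 'M[R]_(n, m)) :=
  [set AB | future X = AB.1 *m past X + AB.2 *m U].

Definition compatible (T1 T2 : nat)
    (U1 : 'M[R]_(m, T1)) (X1 : 'M[R]_(n, T1.+1))
    (U2 : 'M[R]_(m, T2)) (X2 : 'M[R]_(n, T2.+1)) : Prop :=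
  Sigma U1 X1 `&` Sigma U2 X2 !=set0.

Definition linear_measurements (A : 'M[R]_n) (B : 'M[R]_(n, m)) (T : nat)
    (x : nat -> 'cV[R]_n) (u : nat -> 'cV[R]_m) : Prop :=
  forall t : nat, (t < T)%N -> x t.+1 = A *m x t + B *m u t.

Definition switched_trajectory (p : nat)
    (A : 'I_p -> 'M[R]_n) (B : 'I_p -> 'M[R]_(n, m)) (sigma : nat -> 'I_p)
    (x : nat -> 'cV[R]_n) (u : nat -> 'cV[R]_m) : Prop :=
  forall t : nat, x t.+1 = A (sigma t) *m x t + B (sigma t) *m u t.

(* Only sigma(t0), ..., sigma(t0+T-1) drive the transitions between the states
   x(t0), ..., x(t0+T), so sigma may change from time t0+T on. *)
Definition dwells (p : nat) (sigma : nat -> 'I_p) (t0 T : nat) : Prop :=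
  exists j : 'I_p, forall t : nat, (t < T)%N -> sigma (t0 + t)%N = j.

End Data.

(* The kernel of v |-> M v on column vectors; kermx is the kernel of the action
   on row vectors. *)
Definition ker (R : realType) (k l : nat) (M : 'M[R]_(k, l)) : set 'cV[R]_l :=
  [set v | M *m v = 0].

(* Main.v *)
Require Import Defs.
From HB Require Import structures.
From mathcomp Require Import all_boot all_order all_algebra.
From mathcomp Require Import classical_sets reals.

Import GRing.Theory.
Local Open Scope classical_set_scope.
Local Open Scope ring_scope.

(** A pair (A, B) lies in both solution sets exactly when the row block [A B]
    solves the single linear equation N = [A B] M, where M is the matrix of
    stacked past data and N = [X^i_+  X^on_+]; this is [compatible_row_mxP].
    Such an equation is solvable for its left factor if and only if
    ker M is included in ker N ([ker_subP]): both say that the rows of N lie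
    in the row space of M. *)

(** The columns of [cokermx M] all lie in ker M, so the kernel inclusion makes N
    annihilate [cokermx M], which is the test for the row space of N to be
    included in that of M. *)
Lemma ker_subP (R : realType) (k l q : nat) (M : 'M[R]_(k, l)) (N : 'M[R]_(q, l)) :
  ker M `<=` ker N <-> exists D : 'M[R]_(q, k), N = D *m M.
Proof.
split=> [kerMN | [D ->] v]; last first.
  by rewrite /ker /= -mulmxA => ->; rewrite mulmx0.
apply/submxP; rewrite submxE; apply/eqP/matrixP => a j.
have /matrixP/(_ a 0) : N *m col j (cokermx M) = 0.
  by apply: kerMN; rewrite /ker /= colE mulmxA mulmx_coker mul0mx.
by rewrite colE mulmxA -colE !mxE.
Qed.

Lemma compatible_row_mxP (R : realType) (n m T1 T2 : nat)
    (U1 : 'M[R]_(m, T1)) (X1 : 'M[R]_(n, T1.+1))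
    (U2 : 'M[R]_(m, T2)) (X2 : 'M[R]_(n, T2.+1)) :
  compatible U1 X1 U2 X2 <->
  exists D : 'M[R]_(n, n + m),
    row_mx (future X1) (future X2) = D *m block_mx (past X1) (past X2) U1 U2.
Proof.
split=> [[[A B] [/= E1 E2]] | [D]].
  by exists (row_mx A B); rewrite mul_row_block E1 E2.
rewrite -[D]hsubmxK mul_row_block => /eq_row_mx[E1 E2].
by exists (lsubmx D, rsubmx D).
Qed.

Theorem mainTheorem2 (R : realType) (n m p : nat)
    (A : 'I_p -> 'M[R]_n) (B : 'I_p -> 'M[R]_(n, m))
    (* initialization data *)
    (T : 'I_p -> nat)
    (x : 'I_p -> nat -> 'cV[R]_n) (u : 'I_p -> nat -> 'cV[R]_m)
    (Hinit : forall i : 'I_p, linear_measurements (A i) (B i) (T i) (x i) (u i))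
    (* online data: samples t0, ..., t0 + Ton of the switched system *)
    (sigma : nat -> 'I_p) (xs : nat -> 'cV[R]_n) (us : nat -> 'cV[R]_m)
    (Hswitched : switched_trajectory A B sigma xs us)
    (t0 Ton : nat) (Hdwell : dwells sigma t0 Ton)
    (i : 'I_p) :
  let Xi := state_data (T i) (x i) in
  let Ui := input_data (T i) (u i) in
  let Xon := state_data Ton (fun t => xs (t0 + t)%N) in
  let Uon := input_data Ton (fun t => us (t0 + t)%N) in
  compatible Ui Xi Uon Xon <->
  ker (block_mx (past Xi) (past Xon) Ui Uon)
    `<=` ker (row_mx (future Xi) (future Xon)).
Proof.
move=> Xi Ui Xon Uon.
by rewrite compatible_row_mxP ker_subP.
Qed.
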